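(* Let $\mathcal{L},\mathcal{L}'\subseteq\mathbb{S}^n$ be Jordan spaces of the same dimension $m$. If $\mathcal{L}$ degenerates to $\mathcal{L}'$, then the form $\det(\mathcal{L})$ degenerates to the form $\det(\mathcal{L}')$.
   Context: $\mathbb{S}^n$ is the space of complex symmetric $n\times n$ matrices. A Jordan space $\mathcal{L}\subseteq\mathbb{S}^n$ is a linear subspace containing an invertible matrix $U$ and closed under $X\bullet_UY=\frac12(XU^{-1}Y+YU^{-1}X)$. Degeneration of Jordan spaces: if $\mathcal{L},\mathcal{L}'\subseteq\mathbb{S}^n$ are Jordan spaces of dimension $m$ with bases $X_1,\dots,X_m$ and $X_1',\dots,X_m'$, then $\mathcal{L}$ degenerates to $\mathcal{L}'$ if there exist $P\in\mathrm{GL}_n(\mathbb{C}[t^{\pm1}])$ and $Q\in\mathrm{GL}_m(\mathbb{C}[t^{\pm1}])$ such that the entries of $(Y_1,\dots,Y_m):=(PX_1P^\top,\dots,PX_mP^\top)Q$ are matrices with coefficients in $\mathbb{C}[t]$ and $X_i'=\lim_{t\to0}Y_i$ for all $i$. Determinant: for a Jordan space $\mathcal{L}$ with basis $X_1,\dots,X_m$, $\det(\mathcal{L}):=\det(x_1X_1+\dots+x_mX_m)\in\mathbb{C}[x_1,\dots,x_m]_n$, a form of degree $n$ in $m$ variables, well-defined up to an invertible linear change of the coordinates $x_1,\dots,x_m$. Degeneration of forms: for $f,g\in\mathbb{C}[x_1,\dots,x_m]_n$, $f$ degenerates to $g$ if $g\in\overline{\mathrm{GL}_m(\mathbb{C})\cdot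 f}$, where $\mathrm{GL}_m(\mathbb{C})$ acts by linear coordinate changes. *)

(* Defs.v *)
From HB Require Import structures.
From mathcomp Require Import all_boot all_order all_algebra fraction.
From mathcomp Require Import all_classical all_reals all_analysis.
From mathcomp Require Export complex.
(* The notations of mpoly clash with those of analysis. *)
From mathcomp Require Import -(notations) mpoly.

Set Implicit Arguments.
Unset Strict Implicit.
Unset Printing Implicit Defensive.

Import Order.TTheory GRing.Theory Num.Theory.
Import numFieldNormedType.Exports.

Local Open Scope classical_set_scope.
Local Open Scope ring_scope.

Section JordanSpaces.
Variables (C : numClosedFieldType) (n : nat).

Definition jordan_mul (U X Y : 'M[C]_n) : 'M[C]_n :=
  2^-1 *: (X *m invmx U *m Y + Y *m invmx U *m X).

Definition jordan_space (L : {vspace 'M[C]_n}) : Prop :=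
  (forall X, X \in L -> X^T = X) /\
  exists U, [/\ U \in L, U \in unitmx &
    forall X Y, X \in L -> Y \in L -> jordan_mul U X Y \in L].

End JordanSpaces.

Section Degeneration.
Variable C : numClosedFieldType.

(* The ring C[t, t^-1], as a subring of the field of fractions of C[t]. *)
Definition laurent (x : {fraction {poly C}}) : Prop :=
  exists (p : {poly C}) (k : nat), x = tofrac p / tofrac 'X^k.

Definition laurent_GL (n : nat) (P : 'M[{fraction {poly C}}]_n) : Prop :=
  [/\ P \in unitmx, forall i j, laurent (P i j)
    & forall i j, laurent (invmx P i j)].

Definition const_frac_mx (n : nat) (X : 'M[C]_n) : 'M[{fraction {poly C}}]_n :=
  map_mx (fun c => tofrac c%:P) X.

(* The j-th equation says that Y_j has entries in C[t], given by V j. *)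
Definition tuple_degenerates (n m : nat) (X X' : m.-tuple 'M[C]_n) : Prop :=
  exists (P : 'M[{fraction {poly C}}]_n) (Q : 'M[{fraction {poly C}}]_m)
         (V : 'I_m -> 'M[{poly C}]_n),
    [/\ laurent_GL P, laurent_GL Q,
        forall j, \sum_(i < m) Q i j *: (P *m const_frac_mx (tnth X i) *m P^T)
                  = map_mx (@tofrac _) (V j)
      & forall j, map_mx (fun p : {poly C} => p.[t]) (V j) @[t --> (0 : C)^']
                  --> tnth X' j].

(* The existence of such bases does not depend on their choice: a change of
   basis is absorbed by a constant factor of Q. *)
Definition jordan_degenerates (n m : nat) (L L' : {vspace 'M[C]_n}) : Prop :=
  exists X X' : m.-tuple 'M[C]_n,
    [/\ basis_of L X, basis_of L' X' & tuple_degenerates X X'].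

End Degeneration.

Section Forms.
Variable C : numClosedFieldType.

Local Notation "{ 'mpoly' T [ n ] }" := (mpoly n T)
  (at level 0, T, n at level 2, format "{ 'mpoly'  T [ n ] }").

Definition mvar (m : nat) (i : 'I_m) : {mpoly C[m]} :=
  mpolyX C (mnm1 i).

Definition det_form (n m : nat) (X : m.-tuple 'M[C]_n) : {mpoly C[m]} :=
  \det (\sum_(i < m) mvar i *: map_mx (mpolyC m (R := C)) (tnth X i)).

Definition is_form (m d : nat) (f : {mpoly C[m]}) : Prop :=
  f \is ishomog1 d (@mdeg m).

(* f(Ax), the i-th variable being replaced by \sum_j A_ij x_j. *)
Definition lin_subst (m : nat) (A : 'M[C]_m) (f : {mpoly C[m]}) :
    {mpoly C[m]} :=
  comp_mpoly [tuple \sum_(j < m) A i j *: mvar j | i < m] f.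

Definition GL_orbit (m : nat) (f : {mpoly C[m]}) : set {mpoly C[m]} :=
  [set lin_subst A f | A in [set A : 'M[C]_m | A \in unitmx]].

(* The coefficients of the monomials of degree at most d; on forms of degree d
   this is injective, and it carries the topology of the finite-dimensional
   space of these forms. *)
Definition coef_vec (m d : nat) (f : {mpoly C[m]}) :
    'rV[C]_#|{: bmultinom m d.+1}| :=
  \row_k mcoeff (bmnm (enum_val k)) f.

(* The closure is the Euclidean one; for orbits of GL_m it is the Zariski one
   as well. *)
Definition form_degenerates (m d : nat) (f g : {mpoly C[m]}) : Prop :=
  [/\ is_form d f, is_form d g
    & closure (coef_vec d @` GL_orbit f) (coef_vec d g)].

End Forms.

(* Main.v *)
Require Import Defs.
From mathcomp Require Import all_boot all_order all_algebra.
From mathcomp Require Import all_classical all_reals all_analysis.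
From mathcomp Require Import perm fraction.
From mathcomp Require Import -(notations) mpoly.

(** Write f for the form det(L) and suppose that
    V_j = sum_i Q_ij P X_i P^T has entries in C[t] and tends to X'_j at t = 0.
    For each scalar s <> 0 the matrices P(s) and Q(s) are defined and
    invertible, and
      det(sum_j x_j V_j(s)) = det(P(s))^2 f(Q(s) x).
    Since f is homogeneous of degree n and the scalar field is algebraically
    closed, the factor det(P(s))^2 = c^n is absorbed into the substitution: the
    right-hand side is f(c Q(s) x), a point of the orbit of f
    ([pencil_det_orbit]). On the left, the coefficients are polynomials in s, so
    they converge, as s tends to 0, to the coefficients of
    det(sum_j x_j V_j(0)) = det(sum_j x_j X'_j)
    ([form_degenerates_of_polynomial]).

    Two reductions lead to this situation. Elements of C[t, t^-1] only appear
    as fractions with a power of t in the denominator, so P and Q are replaced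
    by polynomial matrices times powers of t; these powers are nonzero scalars
    at s <> 0 and go into the substitution ([tuple_degenerates_polynomial]).
    The bases for which the degeneration is given may differ from those that
    define the two forms; a change of basis on either side multiplies the
    substitution by a constant invertible matrix
    ([polynomial_degeneration_basis]). *)

Set Implicit Arguments.
Unset Strict Implicit.
Unset Printing Implicit Defensive.

Import Order.TTheory GRing.Theory Num.Theory.
Import numFieldNormedType.Exports.

Local Open Scope classical_set_scope.
Local Open Scope ring_scope.
Local Open Scope complex_scope.

(** * Determinants of linear pencils *)

Section PencilDeterminant.
Variables (K : comNzRingType) (n m : nat).
Implicit Types X : 'I_m -> 'M[K]_n.

(** Besides scalars, the coefficient ring will be C[t]: the determinant of a
    family of pencils depending on t is then a single polynomial over C[t],
    which can be specialized at each t. *)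
Definition pencil_det X : mpoly m K :=
  \det (\sum_(i < m) mpolyX K (mnm1 i) *: map_mx (@mpolyC m K) (X i)).

Lemma eq_pencil_det X Y : X =1 Y -> pencil_det X = pencil_det Y.
Proof. by move=> /funext ->. Qed.

Lemma pencil_det_homog X : pencil_det X \is ishomog1 n (@mdeg m).
Proof.
apply: rpred_sum => s _.
rewrite mulr_sign.
pose F i :=
  (\sum_(j < m) mpolyX K (mnm1 j) *: map_mx (@mpolyC m K) (X j)) i (s i).
have homF r : \prod_(i <- r) F i \is ishomog1 (size r) (@mdeg m).
  elim: r => [|i r IHr] /=; first by rewrite big_nil dhomog1.
  rewrite big_cons -add1n dhomogM// /F summxE rpred_sum// => j _.
  by rewrite !mxE mulrC mul_mpolyC rpredZ// dhomogX /= mdeg1.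
have : \prod_(i < n) F i \is ishomog1 n (@mdeg m).
  by have := homF (enum 'I_n); rewrite big_enum size_enum_ord.
by case: ifP => _ //; rewrite rpredN.
Qed.

Lemma pencil_det_congruence (P : 'M[K]_n) X :
  pencil_det (fun i => P *m X i *m P^T)
  = mpolyC m (\det P ^+ 2) * pencil_det X.
Proof.
rewrite /pencil_det.
pose Pm := map_mx (@mpolyC m K) P.
transitivity (\det (Pm *m
    (\sum_(i < m) mpolyX K (mnm1 i) *: map_mx (@mpolyC m K) (X i)) *m Pm^T)).
  congr (\det _); rewrite mulmx_sumr mulmx_suml; apply: eq_bigr => i _.
  by rewrite !map_mxM map_trmx -scalemxAr -scalemxAl.
by rewrite !det_mulmx det_tr det_map_mx mulrC mulrA -expr2 -rmorphXn.
Qed.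

Lemma pencil_det_scale (c : K) X :
  pencil_det (fun i => c *: X i) = mpolyC m (c ^+ n) * pencil_det X.
Proof.
rewrite rmorphXn -detZ; congr (\det _); rewrite scaler_sumr.
by apply: eq_bigr => i _; rewrite map_mxZ scalerA mulrC -scalerA.
Qed.

End PencilDeterminant.

Lemma map_pencil_det (K S : comNzRingType) (f : {rmorphism K -> S}) n m
    (X : 'I_m -> 'M[K]_n) :
  map_mpoly f (pencil_det X) = pencil_det (fun i => map_mx f (X i)).
Proof.
rewrite /pencil_det -det_map_mx; congr (\det _).
rewrite map_mx_sum; apply: eq_bigr => i _.
by apply/matrixP => a b; rewrite !mxE /= rmorphM /= map_mpolyX map_mpolyC.
Qed.

(** * The orbit of the determinant of a pencil *)

Section Forms.
Variable C : numClosedFieldType.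

(** Substituting x_i := sum_j A_ij x_j in sum_i x_i X_i and regrouping by x_j
    lets A act on the matrices X_i by its columns. *)
Lemma lin_subst_pencil_det n m (A : 'M[C]_m) (X : 'I_m -> 'M[C]_n) :
  lin_subst A (pencil_det X) = pencil_det (fun j => \sum_i A i j *: X i).
Proof.
rewrite /lin_subst /pencil_det -det_map_mx; congr (\det _).
rewrite map_mx_sum.
under eq_bigr => i _.
  rewrite (_ : map_mx _ _ =
    \sum_(j < m) mpolyX C (mnm1 j) *: map_mx (@mpolyC m C) (A i j *: X i)).
    over.
  apply/matrixP => a b; rewrite summxE !mxE /= rmorphM /= comp_mpolyC.
  rewrite comp_mpolyXU -tnth_nth tnth_mktuple mulr_suml.
  apply: eq_bigr => j _; rewrite !mxE rmorphM /= /mvar mulrA; congr (_ * _).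
  by rewrite -mul_mpolyC mulrC.
rewrite exchange_big; apply: eq_bigr => j _ /=.
by rewrite map_mx_sum scaler_sumr.
Qed.

Lemma exists_nonzero_root (d : C) n : d != 0 -> (n = 0%N -> d = 1) ->
  exists2 c : C, c != 0 & c ^+ n = d.
Proof.
case: n => [|n] d0 dn; first by exists 1; rewrite ?oner_neq0 // dn.
by exists (n.+1.-root d); rewrite ?rootC_eq0 // rootCK.
Qed.

(** A congruence by P multiplies the determinant by det(P)^2, whereas scaling
    all the matrices by c multiplies it by c^n. Taking c to be an n-th root of
    det(P)^2, the congruence becomes the substitution c A. *)
Lemma pencil_det_orbit n m (X : 'I_m -> 'M[C]_n) (P : 'M[C]_n) (A : 'M[C]_m) :
  P \in unitmx -> A \in unitmx ->
  GL_orbit (pencil_det X)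
    (pencil_det (fun j => \sum_i A i j *: (P *m X i *m P^T))).
Proof.
move=> Pu Au.
have [||c c0 cn] := @exists_nonzero_root (\det P ^+ 2) n.
- by rewrite expf_neq0// -unitfE.
- (* For n = 0, det(P)^2 is the empty determinant 1. *)
  by case: n X P Pu => // X P _ _; rewrite det_mx00 expr1n.
exists (c *: A); first by rewrite /= unitmxZ// unitfE.
rewrite lin_subst_pencil_det.
rewrite (@eq_pencil_det _ _ _ _ (fun j => c *: \sum_i A i j *: X i)); last first.
  by move=> j; rewrite scaler_sumr; apply: eq_bigr => i _; rewrite mxE scalerA.
rewrite pencil_det_scale cn -pencil_det_congruence; apply: eq_pencil_det => j.
rewrite mulmx_sumr mulmx_suml; apply: eq_bigr => i _.
by rewrite -scalemxAr -scalemxAl.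
Qed.

End Forms.

(** * Limits of polynomials and of matrices *)

Section Limits.
Variable C : numFieldType.

Lemma continuous_horner_numField (p : {poly C}) : continuous (horner p).
Proof.
elim/poly_ind: p => [|p c IHp] x.
  have -> : horner (0 : {poly C}) = cst 0 by apply/funext => y; rewrite horner0.
  exact: cst_continuous.
have -> : horner (p * 'X + c%:P) = (fun y => p.[y] * y + c).
  by apply/funext => y; rewrite hornerMXaddC.
exact: (cvgD (cvgM (IHp x) cvg_id) (cvg_cst c)).
Qed.

Lemma cvg_mx (T : Type) (F : set_system T) m n (f : T -> 'M[C]_(m, n))
    (M : 'M[C]_(m, n)) : Filter F ->
  (forall i j, f t i j @[t --> F] --> M i j) -> f @ F --> M.
Proof.
move=> FF cvf A [P MP sPA].
have : \forall t \near F, forall i j, P i j (f t i j).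
  apply: filter_forall => i; apply: filter_forall => j.
  exact: cvf (MP i j).
by apply: filterS => t Pt; apply: sPA.
Qed.

End Limits.

(** * Matrices over Laurent polynomials *)

Section LaurentMatrices.
Variable C : numClosedFieldType.

Lemma laurent_mx m n (P : 'M[{fraction {poly C}}]_(m, n)) :
  (forall i j, laurent (P i j)) ->
  exists (k : nat) (P0 : 'M[{poly C}]_(m, n)),
    tofrac 'X^k *: P = map_mx (@tofrac _) P0.
Proof.
move=> hP.
have /choice[f hf] : forall ij : 'I_m * 'I_n, exists pk : {poly C} * nat,
    P ij.1 ij.2 = tofrac pk.1 / tofrac 'X^(pk.2).
  by move=> [i j]; have [p [k e]] := hP i j; exists (p, k).
pose k := (\max_ij (f ij).2)%N.
exists k, (\matrix_(i, j) ((f (i, j)).1 * 'X^(k - (f (i, j)).2))).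
apply/matrixP => i j; rewrite !mxE (hf (i, j)) /=.
have le : ((f (i, j)).2 <= k)%N by exact: (leq_bigmax (i, j)).
rewrite -{1}(subnK le) exprD !rmorphM /= mulrCA mulrK ?unitfE//.
by rewrite tofrac_eq0 expf_neq0// polyX_eq0.
Qed.

(** The inverse of P is P1 / t^l for some polynomial matrix P1, so P0 P1 is a
    power of t times the identity, and this power is nonzero away from 0. *)
Lemma laurent_GLP n (P : 'M[{fraction {poly C}}]_n) : laurent_GL P ->
  exists (k : nat) (P0 : 'M[{poly C}]_n),
    tofrac 'X^k *: P = map_mx (@tofrac _) P0 /\
    forall s, s != 0 -> map_mx (horner_eval s) P0 \in unitmx.
Proof.
move=> [Pu /laurent_mx[k [P0 hP0]] /laurent_mx[l [P1 hP1]]].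
exists k, P0; split=> // s s0.
have PP : P0 *m P1 = 'X^(k + l)%:M.
  have : map_mx (@tofrac {poly C}) (P0 *m P1) = map_mx (@tofrac _) 'X^(k + l)%:M.
    rewrite map_mxM -hP0 -hP1 -scalemxAl -scalemxAr scalerA mulmxV//.
    by rewrite map_scalar_mx exprD /= rmorphM /= scalemx1.
  move=> /matrixP e; apply/matrixP => i j; apply/eqP.
  by have /eqP := e i j; rewrite [X in X == _]mxE [X in _ == X]mxE tofrac_eq.
have : map_mx (horner_eval s) P0 *m map_mx (horner_eval s) P1 \in unitmx.
  rewrite -map_mxM PP map_scalar_mx unitmxE det_scalar /= horner_evalE hornerXn.
  by rewrite unitfE !expf_neq0.
by rewrite unitmx_mul => /andP[].
Qed.

End LaurentMatrices.

(** * Degenerations as polynomial families of pencils *)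

Section DegenerationCurve.
Variables (C : numClosedFieldType) (n m : nat).
Implicit Types X Y : m.-tuple 'M[C]_n.

(** What remains of a degeneration once the Laurent matrices have been evaluated
    at each nonzero scalar. The limit, of entries in C[t], is a value at 0. *)
Definition polynomial_degeneration X X' (V : 'I_m -> 'M[{poly C}]_n) :=
  (forall j, map_mx (horner_eval 0) (V j) = tnth X' j) /\
  forall s, s != 0 -> exists (P : 'M[C]_n) (A : 'M[C]_m),
    [/\ P \in unitmx, A \in unitmx & forall j,
      map_mx (horner_eval s) (V j) =
      \sum_i A i j *: (P *m tnth X i *m P^T)].

Lemma tuple_degenerates_polynomial X X' :
  tuple_degenerates X X' -> exists V, polynomial_degeneration X X' V.
Proof.
move=> [P [Q [V [/laurent_GLP[k [P0 [hP0 P0u]]] /laurent_GLP[l [Q0 [hQ0 Q0u]]]]]]].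
move=> hV limV; exists V; split=> [j|s s0].
  apply/matrixP => a b; rewrite mxE.
  have lim_horner : (V j a b).[t] @[t --> (0 : C)^'] --> (V j a b).[0].
    by apply: cvg_within_filter; exact: continuous_horner_numField.
  have lim_coord : (V j a b).[t] @[t --> (0 : C)^'] --> tnth X' j a b.
    have := cvg_comp _ _ (limV j) (@coord_continuous _ _ _ a b (tnth X' j)).
    by apply: cvg_trans; apply: near_eq_cvg; apply: nearW => t; rewrite /= mxE.
  exact: (cvg_unique (@norm_hausdorff _ _) lim_horner lim_coord).
(* With P = P0 / t^k and Q = Q0 / t^l, each V_j is t^-(2k + l) times the
   corresponding combination of the polynomial matrices P0 and Q0. *)
exists (map_mx (horner_eval s) P0).
exists (s ^- (k + k + l) *: map_mx (horner_eval s) Q0); split.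
- exact: P0u.
- by rewrite unitmxZ ?Q0u// unitfE invr_neq0// expf_neq0.
move=> j.
have e : 'X^(k + k + l) *: V j =
    \sum_i Q0 i j *: (P0 *m map_mx polyC (tnth X i) *m P0^T).
  suff : map_mx (@tofrac {poly C}) ('X^(k + k + l) *: V j) = map_mx (@tofrac _)
      (\sum_i Q0 i j *: (P0 *m map_mx polyC (tnth X i) *m P0^T)).
    move=> /matrixP e; apply/matrixP => a b; apply/eqP.
    by have /eqP := e a b; rewrite [X in X == _]mxE [X in _ == X]mxE tofrac_eq.
  rewrite map_mxZ -hV scaler_sumr map_mx_sum; apply: eq_bigr => i _.
  have /matrixP/(_ i j) := hQ0; rewrite !mxE => hQij.
  rewrite map_mxZ !map_mxM -map_trmx -hP0 /= -hQij /const_frac_mx -map_mx_comp.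
  rewrite -!scalemxAl [(_ *: P)^T]linearZ /= -!scalemxAr !scalerA !exprD !rmorphM /=.
  congr (_ *: _).
  by rewrite -[LHS]mulrA mulrC mulrA.
have /(congr1 (map_mx (horner_eval s))) := e.
rewrite map_mxZ /= horner_evalE hornerXn => es.
have sn0 : s ^+ (k + k + l) != 0 by rewrite expf_neq0.
rewrite -[LHS](scalerK sn0) es map_mx_sum scaler_sumr; apply: eq_bigr => i _.
rewrite map_mxZ !map_mxM -map_trmx scalerA !mxE; congr (_ *: (_ *m _ *m _)).
by apply/matrixP => a b; rewrite !mxE /= horner_evalE hornerC.
Qed.

(** The coefficients of det(sum_j x_j V_j) are polynomials in t, hence continuous
    at 0, where they give the coefficients of the limit form; at t <> 0 they
    belong to a form in the orbit. *)
Lemma form_degenerates_of_polynomial X X' V :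
  polynomial_degeneration X X' V ->
  form_degenerates n (det_form X) (det_form X').
Proof.
move=> [V0 Vs]; split; [exact: pencil_det_homog|exact: pencil_det_homog|].
pose F := pencil_det V.
pose g s := coef_vec n (map_mpoly (horner_eval s) F).
have g0 : g @ (0 : C)^' --> g 0.
  apply: cvg_mx => i k.
  have gE s : g s i k = (mcoeff (bmnm (enum_val k)) F).[s].
    by rewrite mxE mcoeff_map_mpoly.
  rewrite gE; under eq_cvg do rewrite gE.
  by apply: cvg_within_filter; exact: continuous_horner_numField.
have -> : coef_vec n (det_form X') = g 0.
  rewrite /g map_pencil_det; congr coef_vec; apply: eq_pencil_det => j.
  by rewrite V0.
move=> B /g0 gB.
have [s [gBs s0]] : exists s, B (g s) /\ s != 0.
  have gB0 : \forall s \near (0 : C)^', B (g s) by exact: gB.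
  exact: (filter_ex (filterI gB0 (nbhs_dnbhs_neq (0 : C)))). 
exists (g s); split=> //.
have [P [A [Pu Au e]]] := Vs s s0.
exists (map_mpoly (horner_eval s) F) => //.
by rewrite map_pencil_det (eq_pencil_det e); exact: pencil_det_orbit.
Qed.

Lemma basis_change (L : {vspace 'M[C]_n}) X Y :
  basis_of L X -> basis_of L Y ->
  exists2 B : 'M[C]_m, B \in unitmx &
    forall j, tnth Y j = \sum_i B i j *: tnth X i.
Proof.
move=> hX hY.
have coordE (Z W : m.-tuple _) : basis_of L Z -> basis_of L W ->
    forall j, tnth W j = \sum_i coord Z i (tnth W j) *: tnth Z i.
  move=> hZ hW j; rewrite {1}(coord_basis hZ (basis_mem hW (mem_tnth j W))).
  by apply: eq_bigr => i _; rewrite (tnth_nth 0 Z).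
exists (\matrix_(i, j) coord X i (tnth Y j)); last first.
  by move=> j; rewrite (coordE X Y) //; apply: eq_bigr => i _; rewrite mxE.
suff : (\matrix_(i, j) coord X i (tnth Y j)) *m
       (\matrix_(i, j) coord Y i (tnth X j)) = 1%:M by move/mulmx1_unit => [].
apply/matrixP => i k; rewrite !mxE.
rewrite eq_sym -(coord_free k i (basis_free hX)) -tnth_nth.
rewrite [in RHS](coordE Y X hY hX k) linear_sum; apply: eq_bigr => j _.
by rewrite !mxE linearZ /= mulrC.
Qed.

(** The new family takes the combinations of the V_i that express the new basis
    of L' in the old one. The matrix A becomes D A B, where B and D are the
    base changes in L' and in L. *)
Lemma polynomial_degeneration_basis (L L' : {vspace 'M[C]_n}) X X' Y Y' V :
  basis_of L X -> basis_of L Y -> basis_of L' X' -> basis_of L' Y' ->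
  polynomial_degeneration X X' V ->
  exists W, polynomial_degeneration Y Y' W.
Proof.
move=> hX hY hX' hY' [V0 Vs].
have [D Du hD] := basis_change hY hX.
have [B Bu hB] := basis_change hX' hY'.
pose W j := \sum_i (B i j)%:P *: V i.
have Ws s j : map_mx (horner_eval s) (W j) =
    \sum_i B i j *: map_mx (horner_eval s) (V i).
  rewrite map_mx_sum; apply: eq_bigr => i _.
  by rewrite map_mxZ /= horner_evalE hornerC.
exists W; split=> [j|s s0].
  by rewrite Ws hB; apply: eq_bigr => i _; rewrite V0.
have [P [A [Pu Au e]]] := Vs s s0.
exists P, (D *m A *m B); split=> //; first by rewrite !unitmx_mul Du Au.
move=> j; rewrite Ws.
under eq_bigr => i _.
  rewrite e scaler_sumr.
  under eq_bigr => p _.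
    rewrite hD mulmx_sumr mulmx_suml scaler_sumr scaler_sumr.
    under eq_bigr => q _.
      rewrite -scalemxAr -scalemxAl !scalerA.
      over.
    over.
  over.
under eq_bigr do rewrite exchange_big /=.
rewrite exchange_big /=; apply: eq_bigr => q _.
rewrite mxE scaler_suml; apply: eq_bigr => i _.
rewrite mxE mulr_suml scaler_suml; apply: eq_bigr => p _.
by congr (_ *: _); rewrite mulrC mulrCA mulrC mulrAC.
Qed.

End DegenerationCurve.

Theorem proposition6p4 (R : realType) (n m : nat)
    (L L' : {vspace 'M[R[i]]_n})
    (hL : jordan_space L) (hL' : jordan_space L')
    (dimL : (\dim L = m)%N) (dimL' : (\dim L' = m)%N)
    (hdeg : jordan_degenerates m L L')
    (X X' : m.-tuple 'M[R[i]]_n)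
    (hX : basis_of L X) (hX' : basis_of L' X') :
  form_degenerates n (det_form X) (det_form X').
Proof.
have [Y [Y' [hY hY' /tuple_degenerates_polynomial[V hV]]]] := hdeg.
have [W hW] := polynomial_degeneration_basis hY hX hY' hX' hV.
exact: form_degenerates_of_polynomial hW.
Qed.
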